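(* Suppose we have $n\ge3$ agents with additive, identical, normalized valuations, provided with a prediction of accuracy $\eta<1-\min\left\{\frac{1}{2(n-1+2a)},\frac{1-a^2}{4+(2n-3)a}\right\}$ for some given $a\in(0,1]$; that is, the allowed error between the prediction and the true valuation is $1-\eta>\min\left\{\frac{1}{2(n-1+2a)},\frac{1-a^2}{4+(2n-3)a}\right\}$. Then there is no online algorithm that guarantees an $a$-EFX allocation for all instances with error at most $1-\eta$, even when $T'=T=2n-1$ and the prediction and the true valuation are $3$-value functions.
   Context: Online fair division with predictions and identical valuations: agents $[n]$; goods $g_1,\dots,g_T$ arrive one per time step; all agents share a true additive normalized valuation $v$ ($v(g_t)\ge0$, $\sum_{t\in[T]}v(g_t)=1$, $v(S)=\sum_{g\in S}v(g)$), and before any arrival the algorithm receives a prediction $p=(p(g_1),\dots,p(g_{T'}))$ (an additive normalized valuation over $T'$ predicted goods) and the accuracy level. Error $\frac12\sum_{t=1}^{\max\{T,T'\}}|p(g_t)-v(g_t)|$ (missing entries set to $0$); accuracy $\eta$ means the error is at most $1-\eta$. At time $t$, $v(g_t)$ is revealed and $g_t$ must be irrevocably allocated. For $S\ne\emptyset$, $\bar S=S\setminus\{g\}$ with $g\in\arg\max_{g'\in S}v(S\setminus\{g'\})$, $\bar\emptyset=\emptyset$. An allocation is $a$-EFX if $v(A_i)\ge a\cdot v(\bar A_j)$ for all $i,j$. A function is $k$-value if it takes at most $k$ distinct values. *)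

(* Defs.v *)
From mathcomp Require Import all_boot all_order all_algebra.
Set Implicit Arguments. Unset Strict Implicit. Unset Printing Implicit Defensive.
Import Order.TTheory GRing.Theory Num.Theory.
Local Open Scope ring_scope.

Section FairDiv.
Variable R : realFieldType.

Definition setval (T : finType) (v : T -> R) (S : {set T}) : R :=
  \sum_(g in S) v g.

Definition normalized (T : finType) (v : T -> R) : Prop :=
  (forall g, 0 <= v g) /\ \sum_(g : T) v g = 1.

Definition kvalue (k : nat) (T : finType) (v : T -> R) : Prop :=
  (size (undup [seq v g | g <- enum T]) <= k)%N.

(* prediction error (here T' = T, so no padding needed) *)
Definition pred_error (T : finType) (p v : T -> R) : R :=
  2^-1 * \sum_(g : T) `|p g - v g|.

Definition sbar (T : finType) (v : T -> R) (S : {set T}) : {set T} :=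
  match [pick g in S] with
  | None => set0
  | Some g0 => S :\ (Order.arg_max g0 (fun g => g \in S) (fun g => setval v (S :\ g)))
  end.

Definition aEFX (n : nat) (T : finType) (a : R) (v : T -> R) (A : 'I_n -> {set T}) : Prop :=
  forall i j : 'I_n, setval v (A i) >= a * setval v (sbar v (A j)).

(* An online (deterministic) algorithm with horizon m goods and n agents:
   given the prediction p and the list of values v(g_1),...,v(g_t) revealed
   so far, it irrevocably assigns g_t to an agent. *)
Definition online_alg (n m : nat) := ('I_m -> R) -> seq R -> 'I_n.

Definition revealed (m : nat) (v : 'I_m -> R) (t : 'I_m) : seq R :=
  [seq v g | g <- enum 'I_m & (val g <= val t)%N].

Definition run_alg (n m : nat) (alg : online_alg n m) (p v : 'I_m -> R)
  : 'I_n -> {set 'I_m} :=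
  fun i => [set t : 'I_m | alg p (revealed v t) == i].

End FairDiv.

(* Main.v *)
(** The first n goods have a tiny value s, the next one a value d with
    n s = a d, and the last n - 2 goods a value l >= d.  If this prediction is
    exact, only n - 1 goods are worth at least d, so some agent i gets none of
    them.  A tiny good outside the bundle of i would force, by pigeonhole, a
    bundle with two goods, one of which is worth at least d; as i then holds
    less than n s = a d, the allocation is not a-EFX.  So all tiny goods go to
    i.  If instead the value d turns out to be 0, its mass being moved to the
    last n - 2 goods, one of the other n - 1 agents gets total value 0, while
    the bundle of i keeps a positive value after a removal.  The prediction
    error is d, which can be taken arbitrarily small. *)

Require Import Defs.
From mathcomp Require Import all_boot all_order all_algebra.
From mathcomp Require Import zify lra.
Import Order.TTheory GRing.Theory Num.Theory.
Local Open Scope ring_scope.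

Lemma setval_le (R : realFieldType) (T : finType) (v : T -> R) (A B : {set T}) :
  (forall g, 0 <= v g) -> A \subset B -> setval v A <= setval v B.
Proof.
move=> v0 /subsetP sAB; rewrite /setval [leLHS]big_mkcond [leRHS]big_mkcond.
apply: ler_sum => g _; have := sAB g; case: (g \in A) => [->//|_].
by case: ifP.
Qed.

(** [sbar] removes a good whose removal leaves the most value, so it leaves at least as much as
    removing [g], which keeps [h]. *)
Lemma sbar_ge (R : realFieldType) (T : finType) (v : T -> R) (S : {set T})
    (g h : T) :
  (forall g, 0 <= v g) -> g \in S -> h \in S -> g != h ->
  v h <= setval v (sbar v S).
Proof.
move=> v0 gS hS gh; rewrite /sbar; case: pickP => [g0 g0S|/(_ g)]; last first.
  by rewrite gS.
case: (arg_maxP (fun g => setval v (S :\ g)) g0S) => k kS kmax.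
apply: le_trans (kmax g gS).
have -> : v h = setval v [set h] by rewrite /setval big_set1.
by apply: setval_le => //; rewrite sub1set !inE eq_sym gh.
Qed.

Lemma card_ord_ge (m k : nat) : #|[set g : 'I_m | (k <= g)%N]| = (m - k)%N.
Proof.
rewrite cardsE -sum1_card -(big_geq_mkord k m xpredT (fun=> 1%N)).
by rewrite sum_nat_const_nat muln1.
Qed.

Lemma card_ord_lt (m k : nat) :
  (k <= m)%N -> #|[set g : 'I_m | (g < k)%N]| = k.
Proof.
move=> km; have := cardsC [set g : 'I_m | (k <= g)%N].
rewrite card_ord_ge card_ord => eq_m.
suff -> : [set g : 'I_m | (g < k)%N] = ~: [set g : 'I_m | (k <= g)%N] by lia.
by apply/setP => g; rewrite !inE ltnNge.
Qed.

(** Common shape of the prediction and the perturbed valuation, in blocks of [n], 1 and [n - 2]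
    goods; with the same [x] they agree on the first [n] arrivals. *)
Definition profile (R : realFieldType) (n : nat) (x y z : R) :
    'I_(2 * n).-1 -> R :=
  fun g => if (g < n)%N then x else if (g == n :> nat)%N then y else z.

Arguments profile {R n}.

Lemma profile_ge0 (R : realFieldType) (n : nat) (x y z : R) :
  0 <= x -> 0 <= y -> 0 <= z -> forall g, 0 <= profile (n := n) x y z g.
Proof. by move=> x0 y0 z0 g; rewrite /profile; case: ifP => // _; case: ifP. Qed.

Lemma sum_profile (R : realFieldType) (n : nat) (x y z : R) :
  (2 <= n)%N ->
  \sum_g profile (n := n) x y z g = n%:R * x + y + (n%:R - 2) * z.
Proof.
move=> n2; rewrite /profile.
rewrite -(big_mkord xpredT
  (fun g => if (g < n)%N then x else if g == n then y else z)).
rewrite (big_cat_nat (n := n)) //=; last by lia.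
rewrite (eq_big_nat _ _ (F2 := fun=> x)); last by move=> i /andP[_ ->].
rewrite [X in _ + X]big_ltn; last by lia.
rewrite ltnn eqxx [X in _ + (_ + X)](eq_big_nat _ _ (F2 := fun=> z)); last first.
  by move=> i /andP[ni _]; rewrite ltnNge (ltnW ni) /= gtn_eqF.
rewrite !sumr_const_nat subn0.
have -> : ((2 * n).-1 - n.+1 = n - 2)%N by lia.
by rewrite -(natrB _ n2) !mulr_natl addrA.
Qed.

Lemma kvalue_profile (R : realFieldType) (n : nat) (x y z : R) :
  kvalue 3 (profile (n := n) x y z).
Proof.
apply: (@uniq_leq_size _ _ [:: x; y; z]); first exact: undup_uniq.
move=> w; rewrite mem_undup => /mapP[g _ ->]; rewrite !inE /profile.
by case: ifP; [|case: ifP]; rewrite eqxx ?orbT.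
Qed.

Lemma pred_error_profile (R : realFieldType) (n : nat) (x y z x' y' z' : R) :
  (2 <= n)%N ->
  pred_error (profile (n := n) x y z) (profile x' y' z') =
  2^-1 * (n%:R * `|x - x'| + `|y - y'| + (n%:R - 2) * `|z - z'|).
Proof.
move=> n2; rewrite -sum_profile // /pred_error; congr (_ * _).
by apply: eq_bigr => g _; rewrite /profile; case: ifP => // _; case: ifP.
Qed.

Lemma exists_notin_image {T : finType} {n : nat} (f : T -> 'I_n)
    (A : {set T}) (B : {set 'I_n}) :
  (#|A| + #|B| < n)%N -> exists2 i, i \notin B & forall t, t \in A -> f t != i.
Proof.
move=> ltn.
have : (0 < #|~: (f @: A :|: B)|)%N.
  have leqC : (#|f @: A :|: B| < n)%N.
    rewrite (leq_ltn_trans (leq_card_setU _ _)) // (leq_ltn_trans _ ltn) //.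
    by rewrite leq_add2r leq_imset_card.
  by have := cardsC (f @: A :|: B); rewrite card_ord; lia.
case/card_gt0P => i; rewrite !inE negb_or => /andP[iA iB]; exists i => // t tA.
by apply: contra iA => /eqP <-; apply: imset_f.
Qed.

Lemma aEFX_small_together (R : realFieldType) (n : nat) (a s d l : R)
    (f : 'I_(2 * n).-1 -> 'I_n) :
  (2 <= n)%N -> 0 < a -> 0 < s -> n%:R * s = a * d -> 0 <= d -> d <= l ->
  aEFX a (profile s d l) (fun i => [set t | f t == i]) ->
  exists i, forall t : 'I_(2 * n).-1, (t < n)%N -> f t = i.
Proof.
move=> n2 a0 s0 nsE d0 dl efx; pose v : 'I_(2 * n).-1 -> R := profile s d l.
have v0 g : 0 <= v g by apply: profile_ge0 => //; [exact: ltW | exact: le_trans dl].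
pose S := [set t : 'I_(2 * n).-1 | (t < n)%N].
pose L := [set t : 'I_(2 * n).-1 | (n <= t)%N].
have cardL : #|L| = n.-1 by rewrite card_ord_ge; lia.
have [|i _ iL] := exists_notin_image f L set0.
  by rewrite cardL cards0; lia.
exists i => g0 g0S; apply/eqP; apply: contraT => g0i.
(* The bundle of [i] lies in [S :\ g0], and [S] is worth [n * s = a * d]. *)
have vi : setval v [set t | f t == i] < a * d.
  have vS : setval v S = a * d.
    rewrite /setval (eq_bigr (fun=> s)); last first.
      by move=> g; rewrite inE /v /profile => ->.
    by rewrite sumr_const card_ord_lt ?mulr_natl -?nsE ?mulr_natl //; lia.
  have g0inS : g0 \in S by rewrite inE.
  have vg0 : v g0 = s by rewrite /v /profile g0S.
  rewrite -vS /setval (big_setD1 g0 g0inS) /= vg0.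
  apply: (@le_lt_trans _ _ (setval v (S :\ g0))); last by rewrite ltrDr.
  apply: setval_le => //; apply/subsetP => t; rewrite !inE => /eqP fti.
  apply/andP; split; first by apply: contra g0i => /eqP <-; apply/eqP.
  rewrite ltnNge; apply: contraT; rewrite negbK => nt.
  by have := iL t; rewrite inE nt fti eqxx => /(_ isT).
have [g gT [h [hL gh fgh]]] : exists2 g, g \in g0 |: L &
    exists h, [/\ h \in L, g != h & f g = f h].
  (* Pigeonhole: these [n] goods all go to the [n - 1] agents other than [i]. *)
  have /imset_injP ninj : ~~ (#|f @: (g0 |: L)| == #|g0 |: L|).
    rewrite cardsU1 inE leqNgt g0S /= cardL neq_ltn; apply/orP; left.
    have sub : f @: (g0 |: L) \subset [set~ i].
      apply/subsetP => _ /imsetP[t tT ->]; rewrite !inE.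
      by case/setU1P: tT => [->//|/iL].
    by rewrite (leq_ltn_trans (subset_leq_card sub)) // cardsC1 card_ord add1n.
  have /existsP[g /existsP[h]] : [exists g, [exists h,
      [&& g \in g0 |: L, h \in g0 |: L, g != h & f g == f h]]].
    apply: contraT => nex; case: ninj => g h gT hT fgh; apply/eqP.
    apply: contraT => gh; move/existsPn: nex => /(_ g) /existsPn /(_ h).
    by rewrite gT hT gh fgh eqxx.
  case/and4P => gT hT gh /eqP fgh.
  (* At most one of two distinct goods is [g0]; if it is [h], the roles are swapped. *)
  case/setU1P: (hT) => [hg0|hL]; last by exists g => //; exists h.
  exists h => //; exists g; split => //; last by rewrite eq_sym.
  by case/setU1P: gT gh => [->|//]; rewrite hg0 eqxx.
have dh : d <= v h.
  by move: hL; rewrite inE /v /profile ltnNge => -> /=; case: ifP.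
have := efx i (f g); rewrite leNgt (lt_le_trans vi) // ler_pM2l //.
apply: le_trans dh _; apply: (@sbar_ge _ _ _ _ g) => //; rewrite !inE //.
by rewrite fgh.
Qed.

Lemma not_aEFX_small_together (R : realFieldType) (n : nat) (a s l : R)
    (f : 'I_(2 * n).-1 -> 'I_n) (i : 'I_n) :
  (2 <= n)%N -> 0 < a -> 0 < s -> 0 <= l ->
  (forall t : 'I_(2 * n).-1, (t < n)%N -> f t = i) ->
  ~ aEFX a (profile s 0 l) (fun i => [set t | f t == i]).
Proof.
move=> n2 a0 s0 l0 fi efx.
have m0 : (0 < (2 * n).-1)%N by lia.
have m1 : (1 < (2 * n).-1)%N by lia.
(* Index [n] is left out: that good is worth 0, so [j] may hold it. The other [n - 2] late goods
   cannot reach all [n - 1] agents other than [i]. *)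
pose L := [set t : 'I_(2 * n).-1 | (n.+1 <= t)%N].
have [|j ji jL] := exists_notin_image f L [set i].
  by rewrite card_ord_ge cards1; lia.
rewrite inE in ji.
have := efx j i; rewrite [leRHS]big1 => [|t]; last first.
  rewrite inE => /eqP ftj; rewrite /profile; case: ifP => [tn|ntn].
    by move: ji; rewrite -ftj (fi t tn) eqxx.
  case: ifP => // /negbT neq_tn; have := jL t.
  by rewrite inE ftj eqxx ltn_neqAle eq_sym neq_tn leqNgt ntn => /(_ isT).
rewrite leNgt mulr_gt0 // (lt_le_trans s0) //.
have sE : profile s 0 l (Ordinal m1) = s by rewrite /profile /= ifT //; lia.
rewrite -[leLHS]sE.
apply: (@sbar_ge _ _ _ _ (Ordinal m0)) => //.
- by apply: profile_ge0 => //; exact: ltW.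
- by rewrite inE fi //=; lia.
- by rewrite inE fi //=; lia.
Qed.

Theorem theorem4p9 (R : realFieldType) (n : nat) (a eta : R) :
  (3 <= n)%N -> 0 < a -> a <= 1 ->
  eta < 1 - Num.min (1 / (2 * (n%:R - 1 + 2 * a)))
                    ((1 - a ^+ 2) / (4 + (2 * n%:R - 3) * a)) ->
  forall alg : online_alg R n (2 * n).-1,
  exists p v : 'I_((2 * n).-1) -> R,
    [/\ normalized p /\ normalized v, kvalue 3 p, kvalue 3 v,
        pred_error p v <= 1 - eta
      & ~ aEFX a v (run_alg alg p v)].
Proof.
move=> n3 a0 a1 eta_lt alg.
have n2 : (2 <= n)%N by lia.
have nR : 3 <= n%:R :> R by rewrite ler_nat.
(* Both terms of the minimum are nonnegative, so the allowed error is positive. *)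
have eta1 : 0 < 1 - eta.
  rewrite subr_gt0; apply: lt_le_trans eta_lt _.
  rewrite lerBlDr lerDl le_min !divr_ge0 //; nra.
(* The bound [1 - eta] controls the error; [n * d <= 1] with [a <= 1] gives [d <= l], that is
   [(n - 1 + a) * d <= 1]. *)
pose d := Num.min (1 - eta) n%:R^-1.
have n0 : 0 < n%:R :> R by lra.
have d0 : 0 < d by rewrite lt_min eta1 invr_gt0.
have d_eta : d <= 1 - eta by rewrite ge_min lexx.
have nd1 : n%:R * d <= 1 by rewrite mulrC -ler_pdivlMr // div1r ge_min lexx orbT.
pose s := a * d / n%:R.
have s0 : 0 < s by rewrite divr_gt0 // mulr_gt0.
have nsE : n%:R * s = a * d by rewrite mulrC divfK // gt_eqF.
have k0 : 0 < n%:R - 2 :> R by lra.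
pose l := (1 - d - a * d) / (n%:R - 2).
have klE : (n%:R - 2) * l = 1 - d - a * d by rewrite mulrC divfK // gt_eqF.
have dl : d <= l by rewrite ler_pdivlMr //; nra.
pose l' := l + d / (n%:R - 2).
have kdE : (n%:R - 2) * (d / (n%:R - 2)) = d by rewrite mulrC divfK // gt_eqF.
have e0 : 0 <= d / (n%:R - 2) by rewrite divr_ge0 // ltW.
have l'0 : 0 <= l' by rewrite /l'; lra.
pose p : 'I_(2 * n).-1 -> R := profile s d l.
pose v : 'I_(2 * n).-1 -> R := profile s 0 l'.
have np : normalized p.
  by split; [apply: profile_ge0; lra | rewrite sum_profile // nsE klE; lra].
have nv : normalized v.
  split; first by apply: profile_ge0; lra.
  by rewrite sum_profile // nsE /l' mulrDr klE kdE; lra.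
(* If the algorithm already fails when the prediction is exact, [p] itself is the bad instance, with
   error 0. *)
have [efx_p|nefx_p] := boolP [forall i, forall j,
    setval p (run_alg alg p p i) >= a * setval p (sbar p (run_alg alg p p j))].
- exists p, v; split=> //; try exact: kvalue_profile.
    (* The mass [d] is counted twice, where it leaves and where it arrives; the factor 1/2 makes the
       error [d]. *)
    rewrite pred_error_profile // subrr normr0 subr0.
    have -> : l - l' = - (d / (n%:R - 2)) by rewrite /l'; lra.
    by rewrite normrN (ger0_norm e0) (gtr0_norm d0) kdE; lra.
  have [|i fi] := @aEFX_small_together R n a s d l
    (fun t => alg p (revealed p t)) n2 a0 s0 nsE (ltW d0) dl.
    by move=> i j; exact: (forallP (forallP efx_p i)).
  apply: (@not_aEFX_small_together R n a s l' _ i) => // t tn.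
  (* Up to time [t < n] both runs reveal only values [s], so the algorithm makes the same
     choices. *)
  rewrite -(fi t tn); congr (alg p _); apply/eq_in_map => g.
  by rewrite mem_filter /p /v /profile => /andP[gt _]; rewrite (leq_ltn_trans gt).
- exists p, p; split=> //; try exact: kvalue_profile.
    by rewrite pred_error_profile // !subrr normr0 !mulr0 !addr0 mulr0 ltW.
  by move=> efx; case/negP: nefx_p; apply/forallP => i; apply/forallP => j.
Qed.
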